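(* Let $f(x) = a_0 x^n + a_1 x^{n-1} + \cdots + a_n$ be a polynomial with real coefficients and $a_0 > 0$, and suppose that $x = a$ is the largest positive root of $f(x) = 0$ (in particular, $f$ has a positive root). Let $f_1(x), \dots, f_n(x)$ be the coefficient polynomials of $f$ (with $f_n = f$), and let $b$ be the largest positive real number that is a root of at least one of the polynomials $f_1(x), \dots, f_n(x)$. Then the numbers $$f_1(b), f_2(b), \dots, f_{n-1}(b), f_n(b)$$ are nonnegative and at least one of them is strictly positive. Moreover, no value smaller than $b$ works, while every value greater than or equal to $b$ works, where a real number $c$ is said to work if the quotient polynomial and the remainder in the division of $f(x)$ by $x - c$ have all their nonzero coefficients positive, i.e. if $f_1(c), f_2(c), \dots, f_n(c)$ are all nonnegative.
   Context: For a real polynomial $f(x) = a_0 x^n + a_1 x^{n-1} + \cdots + a_n$ with $a_0 > 0$, the coefficient polynomials $f_0, f_1, \dots, f_n$ are defined recursively by $f_0(x) := a_0$ and $f_k(x) := x f_{k-1}(x) + a_k$ for $k = 1, \dots, n$. Thus $f_n(x) = f(x)$, and for every real number $c$ the division algorithm gives $$f(x) = (x - c)\{f_0(c) x^{n-1} + f_1(c) x^{n-2} + \cdots + f_{n-1}(c)\} + f_n(c),$$ so that $f_0(c), \dots, f_{n-1}(c)$ are the coefficients of the quotient and $f_n(c)$ is the remainder when $f(x)$ is divided by $x - c$.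
   Formalization: The claim that at least one of f_1(b),…,f_n(b) is strictly positive is asserted only when f(x) is not a_0x^n + a_1x^{n-1}; for such f (e.g. x − 1, where b = 1) all these numbers are zero, so the printed claim fails. *)

(* Defs.v *)
From HB Require Import structures.
From mathcomp Require Import all_boot all_order all_algebra.
From mathcomp Require Import reals.

Set Implicit Arguments.
Unset Strict Implicit.
Unset Printing Implicit Defensive.

Import Order.TTheory GRing.Theory Num.Theory.
Local Open Scope ring_scope.

(* The coefficients are numbered from the leading one down, so that
   f = a_0 x^n + a_1 x^(n-1) + ... + a_n with n = (size f).-1 and
   a_k = dcoef f k. Meaningful only for k <= n: for k > n the truncated
   subtraction returns a_n. *)
Definition dcoef (R : nzRingType) (f : {poly R}) (k : nat) : R :=
  f`_((size f).-1 - k).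

(* Meaningful only for k <= (size f).-1, like dcoef. *)
Fixpoint coefpoly (R : nzRingType) (f : {poly R}) (k : nat) : {poly R} :=
  if k is k'.+1 then 'X * coefpoly f k' + (dcoef f k)%:P else (dcoef f 0)%:P.

Definition largest_pos (R : realType) (P : R -> Prop) (x : R) : Prop :=
  [/\ 0 < x, P x & forall y, 0 < y -> P y -> y <= x].

Definition nz_coefs_pos (R : realType) (p : {poly R}) : Prop :=
  forall i, p`_i != 0 -> 0 < p`_i.

Definition works (R : realType) (f : {poly R}) (c : R) : Prop :=
  nz_coefs_pos (f %/ ('X - c%:P)) /\ nz_coefs_pos (f %% ('X - c%:P)).

Lemma coefpoly_coef (R : nzRingType) (f : {poly R}) (k i : nat) :
  (coefpoly f k)`_i = if (i <= k)%N then dcoef f (k - i) else 0.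
Proof.
elim: k i => [|k IHk] [|i] /=.
- by rewrite coefC.
- by rewrite coefC.
- by rewrite coefD coefXM coefC add0r.
- by rewrite coefD coefXM coefC addr0 /= IHk.
Qed.

Lemma coefpoly_last (R : nzRingType) (f : {poly R}) :
  coefpoly f (size f).-1 = f.
Proof.
apply/polyP => i; rewrite coefpoly_coef /dcoef.
case: leqP => [le_in|lt_ni]; first by rewrite subKn.
by rewrite nth_default //; case: (size f) lt_ni.
Qed.

(* Main.v *)
Require Import Defs.
From HB Require Import structures.
From mathcomp Require Import all_boot all_order all_algebra.
From mathcomp Require Import reals ring.
From mathcomp Require polyrcf.

Set Implicit Arguments.
Unset Strict Implicit.
Unset Printing Implicit Defensive.

Import Order.TTheory GRing.Theory Num.Theory.
Local Open Scope ring_scope.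

(** Write [f_k] for [coefpoly f k] and [a_k] for [dcoef f k].  By Horner's
    scheme, [f_0(c), ..., f_{n-1}(c)] are the coefficients of the quotient of
    [f] by [x - c] and [f_n(c)] is the remainder.  Since [f_0 = a_0 > 0], the
    number [c] works exactly when [f_1(c), ..., f_n(c)] are nonnegative
    ([works_iff]).

    Every [f_k] has leading coefficient [a_0 > 0].  If [f_k(c) < 0] for some
    [c >= b], the intermediate value theorem gives a root of [f_k] beyond [c],
    hence beyond [b], against the maximality of [b] ([coefpoly_ge0_from]).  So
    every [c >= b] works.

    In the other direction, the recursion [f_k(x) = x f_{k-1}(x) + a_k]
    propagates growth: if all [f_k(c)] are nonnegative and [y > 0] lies above
    [c], then all [f_k(y)] are positive ([coefpoly_gt0_above]).  With [y = b]
    this contradicts that some [f_k], [k >= 1], vanishes at [b]; so no [c < b]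
    works, whatever the sign of [c].

    Finally, if all [f_k(b)] vanish, then [a_k = f_k(b) - b f_{k-1}(b) = 0] for
    every [k >= 2], and [f] reduces to its two leading terms
    ([coefpoly_roots_binomial]).  This is a genuine exception: for
    [f = x^n - x^(n-1)] one has [b = 1], a root of every [f_k]. *)

Section Horner.
Variables (R : nzRingType) (f : {poly R}).

Lemma coefpolyS k :
  coefpoly f k.+1 = 'X * coefpoly f k + (dcoef f k.+1)%:P.
Proof. by []. Qed.

Lemma size_coefpoly k : dcoef f 0 != 0 -> size (coefpoly f k) = k.+1.
Proof.
move=> a0N0; apply/eqP; rewrite eqn_leq; apply/andP; split.
  by apply/leq_sizeP => j lt_kj; rewrite coefpoly_coef leqNgt lt_kj.
rewrite ltnNge; apply/negP => /leq_sizeP /(_ k (leqnn k)) /eqP.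
by rewrite coefpoly_coef leqnn subnn (negPf a0N0).
Qed.

Lemma lead_coefpoly k :
  dcoef f 0 != 0 -> lead_coef (coefpoly f k) = dcoef f 0.
Proof.
by move=> a0N0; rewrite lead_coefE size_coefpoly // coefpoly_coef leqnn subnn.
Qed.

End Horner.

Section CommutativeHorner.
Variables (R : comNzRingType) (f : {poly R}) (c : R).

Lemma horner_coefpolyS k :
  (coefpoly f k.+1).[c] = c * (coefpoly f k).[c] + dcoef f k.+1.
Proof. by rewrite coefpolyS !hornerE. Qed.

(** The coefficient of ['X^i] in the quotient of [f_k] is [f_{k-1-i}(c)]: the
    coefficient polynomials are numbered from the leading coefficient down. *)
Lemma coefpoly_division k :
  coefpoly f k =
    (\poly_(i < k) (coefpoly f (k.-1 - i)).[c]) * ('X - c%:P)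
    + (coefpoly f k).[c]%:P.
Proof.
elim: k => [|k IHk]; first by rewrite poly_def big_ord0 mul0r add0r /= hornerC.
have -> : \poly_(i < k.+1) (coefpoly f (k - i)).[c] =
    'X * (\poly_(i < k) (coefpoly f (k.-1 - i)).[c]) + (coefpoly f k).[c]%:P.
  apply/polyP => -[|i]; rewrite coefD coefXM coefC !coef_poly /=.
    by rewrite add0r subn0.
  by rewrite ltnS addr0; case: k {IHk} => [|k] //=; rewrite subSS.
rewrite horner_coefpolyS coefpolyS {1}IHk.
set q := \poly_(i < k) _; set v := (coefpoly f k).[c].
by rewrite polyCD polyCM; ring.
Qed.

(** Two consecutive zeros force the constant term of the second one to
    vanish, which empties [f] below its two leading terms. *)
Lemma coefpoly_roots_binomial n :
    (0 < n)%N -> size f = n.+1 ->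
    (forall k, (1 <= k <= n)%N -> (coefpoly f k).[c] = 0) ->
  f = dcoef f 0 *: 'X^n + dcoef f 1 *: 'X^(n - 1).
Proof.
move=> n_gt0 szf fk0.
have ak0 k : (2 <= k <= n)%N -> dcoef f k = 0.
  case: k => [|[|k]] // /andP[_ le_kn].
  have := horner_coefpolyS k.+1.
  by rewrite !fk0 ?mulr0 ?add0r ?le_kn ?(ltnW le_kn).
have fE : f = coefpoly f n by rewrite -[LHS]coefpoly_last szf.
apply/polyP => i; rewrite {1}fE coefpoly_coef coefD !coefZ !coefXn subn1.
case: (ltngtP i n) => [lt_in | lt_ni | ->].
- rewrite mulr0 add0r; case: eqP => [-> | /eqP iN].
    by rewrite mulr1; congr dcoef; case: (n) n_gt0 => // m _; rewrite subSnn.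
  rewrite mulr0 ak0 // leq_subr andbT ltn_subRL addn1 ltn_neqAle lt_in andbT.
  by apply: contraNneq iN => <-.
- rewrite mulr0 add0r (_ : (_ == _) = false) ?mulr0 //.
  by rewrite gtn_eqF // (leq_ltn_trans (leq_pred n)).
rewrite mulr1 subnn (_ : (_ == _) = false) ?mulr0 ?addr0 //.
by rewrite gtn_eqF // ltn_predL.
Qed.

End CommutativeHorner.

(** Passing from [x] to [y] multiplies a positive value by something larger and
    adds the same [a_k], so [f_k(y) >= f_k(x)] and positivity both persist in
    the recursion; the sign of [x] is irrelevant because
    [x f_{k-1}(x) <= 0 < y f_{k-1}(y)] when [x <= 0]. *)
Lemma coefpoly_gt0_above (R : realDomainType) (f : {poly R}) (n : nat)
    (x y : R) :
    0 < dcoef f 0 -> x < y -> 0 < y ->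
    (forall k, (1 <= k <= n)%N -> 0 <= (coefpoly f k).[x]) ->
  forall k, (k <= n)%N -> 0 < (coefpoly f k).[y].
Proof.
move=> a0_gt0 lt_xy y_gt0 fx_ge0 k le_kn.
have fx0_ge0 j : (j <= n)%N -> 0 <= (coefpoly f j).[x].
  by case: j => [|j] le_jn; [rewrite /= hornerC ltW | apply: fx_ge0].
suff [] : (coefpoly f k).[x] <= (coefpoly f k).[y] /\ 0 < (coefpoly f k).[y].
  by [].
elim: k le_kn => [|k IHk] lt_kn; first by rewrite /= !hornerC.
have [le_xy_k fy_gt0] := IHk (ltnW lt_kn).
have lt_xy_S : (coefpoly f k.+1).[x] < (coefpoly f k.+1).[y].
  rewrite !horner_coefpolyS ltrD2r.
  have [x_le0 | x_gt0] := leP x 0.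
    apply: (@le_lt_trans _ _ 0); last exact: mulr_gt0.
    exact: mulr_le0_ge0 x_le0 (fx0_ge0 _ (ltnW lt_kn)).
  apply: (@le_lt_trans _ _ (x * (coefpoly f k).[y])).
    by rewrite ler_pM2l.
  by rewrite ltr_pM2r.
by split; [apply: ltW | apply: le_lt_trans lt_xy_S; apply: fx0_ge0].
Qed.

Lemma root_above (R : rcfType) (p : {poly R}) (c : R) :
  0 < lead_coef p -> p.[c] < 0 -> exists2 r, c < r & root p r.
Proof.
move=> lp_gt0 pc_lt0; have [M pM] := polyrcf.poly_pinfty_gt_lc lp_gt0.
pose d := Num.max M c.
have pd_ge0 : 0 <= p.[d].
  by apply: le_trans (ltW lp_gt0) (pM _ _); rewrite le_max lexx.
have le_cd : c <= d by rewrite le_max lexx orbT.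
have pcd : p.[c] <= 0 <= p.[d] by rewrite (ltW pc_lt0) pd_ge0.
have [r /andP[le_cr _] pr0] := poly_ivt le_cd pcd.
exists r => //; rewrite lt_neqAle le_cr andbT.
by apply: contraTneq pc_lt0 => ->; rewrite (rootP pr0) ltxx.
Qed.

Lemma coefpoly_ge0_from (R : rcfType) (f : {poly R}) (k : nat) (b c : R) :
    0 < dcoef f 0 -> (forall r, b < r -> ~~ root (coefpoly f k) r) -> b <= c ->
  0 <= (coefpoly f k).[c].
Proof.
move=> a0_gt0 no_root le_bc; rewrite leNgt; apply/negP => fc_lt0.
have [|r lt_cr fr0] := root_above _ fc_lt0.
  by rewrite lead_coefpoly ?gt_eqF.
by have /negP := no_root r (le_lt_trans le_bc lt_cr).
Qed.

Section Works.
Variable R : realType.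

Lemma nz_coefs_posE (p : {poly R}) :
  nz_coefs_pos p <-> forall i, 0 <= p`_i.
Proof.
split=> p_ge i; last by rewrite lt_neqAle eq_sym => ->; apply: p_ge.
by have [-> // | /p_ge /ltW] := eqVneq p`_i 0.
Qed.

Lemma works_iff (f : {poly R}) (n : nat) (c : R) :
    size f = n.+1 -> 0 < dcoef f 0 ->
  works f c <-> forall k, (1 <= k <= n)%N -> 0 <= (coefpoly f k).[c].
Proof.
move=> szf a0_gt0; rewrite /works !nz_coefs_posE.
have sz_r : (size (coefpoly f n).[c]%:P < size ('X - c%:P)%R)%N.
  by rewrite size_XsubC ltnS size_polyC_leq1.
have fE : f = (\poly_(i < n) (coefpoly f (n.-1 - i)).[c]) * ('X - c%:P)
              + (coefpoly f n).[c]%:P.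
  by rewrite -coefpoly_division -[LHS]coefpoly_last szf.
have -> : f %/ ('X - c%:P) = \poly_(i < n) (coefpoly f (n.-1 - i)).[c].
  by rewrite {1}fE divp_addl_mul_small.
have -> : f %% ('X - c%:P) = (coefpoly f n).[c]%:P.
  by rewrite {1}fE modp_addl_mul_small.
split=> [[q_ge0 r_ge0] k /andP[k_gt0 le_kn] | fc_ge0].
  have [->|kNn] := eqVneq k n; first by have := r_ge0 0%N; rewrite coefC.
  have lt_kn : (k < n)%N by rewrite ltn_neqAle kNn.
  have le_kn1 : (k <= n.-1)%N by rewrite -ltnS (ltn_predK lt_kn).
  have := q_ge0 (n.-1 - k)%N; rewrite coef_poly subKn // ifT //.
  by rewrite -(ltn_predK lt_kn) /= ltnS leq_subr.
have fc0_ge0 k : (k <= n)%N -> 0 <= (coefpoly f k).[c].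
  by case: k => [|k] le_kn; [rewrite /= hornerC ltW | apply: fc_ge0].
split=> i; last by rewrite coefC; case: eqP => // _; apply: fc0_ge0.
rewrite coef_poly; case: ifP => // _; apply: fc0_ge0.
exact: leq_trans (leq_subr _ _) (leq_pred _).
Qed.

End Works.

Theorem theorem5 (R : realType) (f : {poly R}) (n : nat) (a b : R)
    (hn : size f = n.+1) (ha0 : 0 < dcoef f 0)
    (ha : largest_pos (fun x => root f x) a)
    (hb : largest_pos
            (fun x => exists2 k, (1 <= k <= n)%N & root (coefpoly f k) x) b) :
  [/\ forall k, (1 <= k <= n)%N -> 0 <= (coefpoly f k).[b],
      f <> dcoef f 0 *: 'X^n + dcoef f 1 *: 'X^(n - 1) ->
        exists2 k, (1 <= k <= n)%N & 0 < (coefpoly f k).[b],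
      forall c : R, c < b -> ~ works f c,
      forall c : R, b <= c -> works f c
    & forall c, works f c <->
        (forall k, (1 <= k <= n)%N -> 0 <= (coefpoly f k).[c])].
Proof.
have [b_gt0 [j /andP[j_gt0 le_jn] fjb0] b_max] := hb.
have worksE c := works_iff c hn ha0.
have from_b c : b <= c ->
    forall k, (1 <= k <= n)%N -> 0 <= (coefpoly f k).[c].
  move=> le_bc k k_in; apply: (@coefpoly_ge0_from _ _ _ b) => // r lt_br.
  apply/negP => fr0; have := b_max r (lt_trans b_gt0 lt_br).
  by rewrite leNgt lt_br => /(_ (ex_intro2 _ _ k k_in fr0)).
split=> [|f_neq|c lt_cb /worksE fc_ge0|c le_bc|//].
- exact: from_b.
- have [/existsP[k /andP[k_gt0 fk_gt0]] | /existsPn fk_le0] :=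
    boolP [exists k : 'I_n.+1, (0 < k)%N && (0 < (coefpoly f k).[b])].
    by exists k; rewrite // k_gt0 -ltnS ltn_ord.
  case: f_neq; apply: (@coefpoly_roots_binomial _ _ b) => //.
    exact: leq_trans j_gt0 le_jn.
  move=> k /[dup] k_in /andP[k_gt0 le_kn]; apply: le_anti.
  rewrite from_b // andbT.
  by have := fk_le0 (Ordinal (le_kn : (k < n.+1)%N)); rewrite /= k_gt0 -leNgt.
- have := coefpoly_gt0_above ha0 lt_cb b_gt0 fc_ge0 le_jn.
  by rewrite (rootP fjb0) ltxx.
- exact/worksE/from_b.
Qed.
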